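(* Let $K\subset\mathbb{R}^n$ be an isotone projection cone generated by linearly independent vectors $b_1,\ldots,b_n$, and let $\bar x\in\mathbb{R}^n$ with its representation $\bar x=\sum_{i\in I^+_{\bar x}}\bar\alpha_i b_i+\sum_{j\in I^-_{\bar x}}\bar\beta_j u_j$. Then the Mordukhovich coderivative of $P_K$ at $\bar x$ is given, for all $y\in\mathbb{R}^n$, by $$D^*P_K(\bar x)(y)=\bigcup_{I,J\subset I^\bullet_{\bar x},\ I\cap J=\emptyset}\left\{z\in\mathbb{R}^n\;\middle|\;\begin{array}{ll}\langle z,b_i\rangle=\langle y,b_i\rangle & \forall i\in I^+_{\bar x}\cup I,\\ \langle z,b_i\rangle\le\langle y,b_i\rangle & \forall i\in I^\bullet_{\bar x}\setminus(I\cup J),\\ \langle z,u_j\rangle=0 & \forall j\in I^-_{\bar x}\cup J,\\ \langle z,u_j\rangle\le0 & \forall j\in I^\bullet_{\bar x}\setminus(I\cup J)\end{array}\right\}.$$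
   Context: $N=\{1,\ldots,n\}$ with $n\ge1$. For linearly independent $b_1,\ldots,b_n\in\mathbb{R}^n$, the cone generated by them is $K=\{\sum_{i=1}^n\alpha_i b_i\mid \alpha_i\ge 0\}$; the associated vectors $u_1,\ldots,u_n$ are determined by $\langle u_j,b_i\rangle=-\delta_{ij}$ (Kronecker delta). $P_K$ denotes the Euclidean metric projection onto $K$. $K$ is an isotone projection cone if for all $x,y$ with $y-x\in K$ one has $P_K(y)-P_K(x)\in K$; it is known that this is equivalent to $\langle u_j,u_k\rangle\le 0$ for all $j\neq k$. Index sets: it is known that for every $x\in\mathbb{R}^n$ there is a unique subset $I\subset N$ such that $x=\sum_{i\in N\setminus I}\alpha_i b_i+\sum_{j\in I}\beta_j u_j$ with $\beta_j>0$ for all $j\in I$ and $\alpha_i\ge0$ for all $i\in N\setminus I$ (the coefficients are then unique, and $P_K(x)=\sum_{i\in N\setminus I}\alpha_i b_i$). With this $I$, define $I_x^+:=\{i\in N\setminus I\mid\alpha_i>0\}$, $I_x^\bullet:=\{i\in N\setminus I\mid\alpha_i=0\}$, $I_x^-:=I$. Fréchet normal cone of $\Omega$ at $\bar w\in\Omega$: $\widehat N_\Omega(\bar w)=\{z\mid\limsup_{w\to\bar w,\,w\in\Omega}\langle z,w-\bar w\rangle/\|w-\bar w\|\le0\}$. Limiting (Mordukhovich) normal cone: $N_\Omega(\bar w)=\{z\mid\exists\,w^k\to\bar w,\ w^k\in\Omega,\ z^k\to z,\ z^k\in\widehat N_\Omega(w^k)\ \forall k\}$. Mordukhovich coderivative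 of a single-valued map $f:\mathbb{R}^n\to\mathbb{R}^n$: $D^*f(\bar x)(y)=\{z\in\mathbb{R}^n\mid(z,-y)\in N_{\operatorname{gph}f}(\bar x,f(\bar x))\}$. *)

(* Defs.v *)
From HB Require Import structures.
From mathcomp Require Import all_boot all_order all_algebra.
From mathcomp Require Import all_classical all_reals all_analysis.

Set Implicit Arguments.
Unset Strict Implicit.
Unset Printing Implicit Defensive.

Import Order.TTheory GRing.Theory Num.Theory.
Import numFieldNormedType.Exports.

Local Open Scope classical_set_scope.
Local Open Scope ring_scope.

Definition dotp (R : realType) (m : nat) (x y : 'rV[R]_m) : R :=
  \sum_(i < m) x ord0 i * y ord0 i.

(* The library norm on matrices is the sup norm. *)
Definition enorm (R : realType) (m : nat) (x : 'rV[R]_m) : R :=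
  Num.sqrt (dotp x x).

Definition gen_cone (R : realType) (n : nat) (b : 'I_n -> 'rV[R]_n) :
    set 'rV[R]_n :=
  [set x | exists2 a : 'I_n -> R,
    forall i, 0 <= a i & x = \sum_(i < n) a i *: b i].

(* The default value 0 is only taken where no nearest point exists. *)
Definition metric_proj (R : realType) (n : nat) (K : set 'rV[R]_n)
    (x : 'rV[R]_n) : 'rV[R]_n :=
  xget 0 [set p | K p /\ forall q, K q -> enorm (x - p) <= enorm (x - q)].

Definition isotone_projection (R : realType) (n : nat) (K : set 'rV[R]_n) :
    Prop :=
  forall x y, K (y - x) -> K (metric_proj K y - metric_proj K x).

(* A single family c holds all coefficients: c i is alpha_i for i outside I
   and beta_i for i in I, so that both I and c are uniquely determined. *)
Definition is_repr (R : realType) (n : nat) (b u : 'I_n -> 'rV[R]_n)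
    (x : 'rV[R]_n) (I : {set 'I_n}) (c : {ffun 'I_n -> R}) : Prop :=
  [/\ x = \sum_(i in ~: I) c i *: b i + \sum_(j in I) c j *: u j,
      forall j, j \in I -> 0 < c j
    & forall i, i \in ~: I -> 0 <= c i].

Definition idx_neg (R : realType) (n : nat) (b u : 'I_n -> 'rV[R]_n)
    (x : 'rV[R]_n) : {set 'I_n} :=
  xget finset.set0 [set I | exists c, is_repr b u x I c].

Definition repr_coef (R : realType) (n : nat) (b u : 'I_n -> 'rV[R]_n)
    (x : 'rV[R]_n) : {ffun 'I_n -> R} :=
  xget [ffun=> 0] [set c | is_repr b u x (idx_neg b u x) c].

Definition idx_pos (R : realType) (n : nat) (b u : 'I_n -> 'rV[R]_n)
    (x : 'rV[R]_n) : {set 'I_n} :=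
  [set i in ~: idx_neg b u x | 0 < repr_coef b u x i]%SET.

Definition idx_zero (R : realType) (n : nat) (b u : 'I_n -> 'rV[R]_n)
    (x : 'rV[R]_n) : {set 'I_n} :=
  [set i in ~: idx_neg b u x | repr_coef b u x i == 0]%SET.

(* The limsup runs over w <> wbar; at an isolated point of Omega it is -oo. *)
Definition frechet_normal (R : realType) (m : nat) (Omega : set 'rV[R]_m)
    (wbar : 'rV[R]_m) : set 'rV[R]_m :=
  [set z : 'rV[R]_m | Omega wbar /\
    (limf_esup (fun w : 'rV[R]_m => (dotp z (w - wbar) / enorm (w - wbar))%:E)
       (within Omega wbar^') <= 0)%E].

Definition limiting_normal (R : realType) (m : nat) (Omega : set 'rV[R]_m)
    (wbar : 'rV[R]_m) : set 'rV[R]_m :=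
  [set z : 'rV[R]_m | Omega wbar /\ exists w v : nat -> 'rV[R]_m,
    [/\ w @ \oo --> wbar, v @ \oo --> z, forall k, Omega (w k)
      & forall k, frechet_normal Omega (w k) (v k)]].

(* R^n x R^n is represented as row vectors of length n + n, so that its inner
   product and Euclidean norm are dotp and enorm. *)
Definition graph (R : realType) (n : nat) (f : 'rV[R]_n -> 'rV[R]_n) :
    set 'rV[R]_(n + n) :=
  [set row_mx x (f x) | x in [set: 'rV[R]_n]].

Definition coderivative (R : realType) (n : nat) (f : 'rV[R]_n -> 'rV[R]_n)
    (x y : 'rV[R]_n) : set 'rV[R]_n :=
  [set z | limiting_normal (graph f) (row_mx x (f x)) (row_mx z (- y))].

(* Main.v *)
Require Import Defs.
From HB Require Import structures.
From mathcomp Require Import all_boot all_order all_algebra.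
From mathcomp Require Import all_classical all_reals all_analysis.
From mathcomp Require Import ring lra.

(* Moreau's decomposition writes x as [\sum_i al_i b_i + \sum_i be_i u_i] with
   nonnegative al, be such that [al_i be_i = 0]; the first sum is P_K(x). The
   projection is nonexpansive, so al and be depend continuously on x, and near x the
   graph of P_K is a product over i of two-piece curves in the (al_i, be_i)-planes.
   With [s_i = <z - y, b_i>] and [r_i = <z, u_i>], the pair (z, -y) is therefore a
   Frechet normal at x iff for every i:
     s_i = 0 if al_i > 0,  r_i = 0 if be_i > 0,  s_i <= 0 and r_i <= 0 if both vanish.
   Arbitrarily close to x, each i with al_i = be_i = 0 can be moved into either of the
   first two cases, independently of the others: I collects those moved into the first
   and J those moved into the second. *)

Set Implicit Arguments.
Unset Strict Implicit.
Unset Printing Implicit Defensive.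

Import Order.TTheory GRing.Theory Num.Theory.
Import numFieldNormedType.Exports.

Local Open Scope classical_set_scope.
Local Open Scope ring_scope.

(** * Bilinearity, positivity and continuity of the Euclidean inner product *)

Section InnerProduct.
Context {R : realType} {m : nat}.
Implicit Types (x y z : 'rV[R]_m) (a : R).

Lemma dotpC x y : dotp x y = dotp y x.
Proof. by apply: eq_bigr => i _; rewrite mulrC. Qed.

Lemma dotpDl x y z : dotp (x + y) z = dotp x z + dotp y z.
Proof. by rewrite -big_split; apply: eq_bigr => i _; rewrite mxE mulrDl. Qed.

Lemma dotpZl a x y : dotp (a *: x) y = a * dotp x y.
Proof. by rewrite /dotp mulr_sumr; apply: eq_bigr => i _; rewrite mxE mulrA. Qed.

Lemma dotpDr x y z : dotp x (y + z) = dotp x y + dotp x z.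
Proof. by rewrite dotpC dotpDl !(dotpC x). Qed.

Lemma dotpZr a x y : dotp x (a *: y) = a * dotp x y.
Proof. by rewrite dotpC dotpZl dotpC. Qed.

Lemma dotpNl x y : dotp (- x) y = - dotp x y.
Proof. by rewrite -scaleN1r dotpZl mulN1r. Qed.

Lemma dotpNr x y : dotp x (- y) = - dotp x y.
Proof. by rewrite dotpC dotpNl dotpC. Qed.

Lemma dotpBl x y z : dotp (x - y) z = dotp x z - dotp y z.
Proof. by rewrite dotpDl dotpNl. Qed.

Lemma dotpBr x y z : dotp x (y - z) = dotp x y - dotp x z.
Proof. by rewrite dotpDr dotpNr. Qed.

Lemma dotp0r x : dotp x 0 = 0.
Proof. by rewrite -(scale0r 0) dotpZr mul0r. Qed.

Lemma dotp_sumr (I : Type) (r : seq I) (P : pred I) (F : I -> 'rV[R]_m) x :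
  dotp x (\sum_(i <- r | P i) F i) = \sum_(i <- r | P i) dotp x (F i).
Proof.
elim/big_rec2: _ => [|i y z _ IH]; first exact: dotp0r.
by rewrite dotpDr IH.
Qed.

Lemma dotp_ge0 x : 0 <= dotp x x.
Proof. by apply: sumr_ge0 => i _; rewrite -expr2 sqr_ge0. Qed.

Lemma dotp_eq0 x : (dotp x x == 0) = (x == 0).
Proof.
apply/eqP/eqP => [/eqP|->]; last exact: dotp0r.
rewrite psumr_eq0 => [/allP x0|i _]; last by rewrite -expr2 sqr_ge0.
apply/rowP => i; have := x0 i (mem_index_enum i).
by rewrite mxE mulf_eq0 orbb => /eqP.
Qed.

(** The sup norm is attained at one coordinate, whose square is a summand of [dotp x x]. This turns
    Euclidean estimates into statements about the ambient topology. *)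
Lemma mx_norm_sqr_le_dotp x : `|x| ^+ 2 <= dotp x x.
Proof.
have [->|/mx_norm_neq0 [[i j] /= xij]] := eqVneq `|x| 0.
  by rewrite expr0n dotp_ge0.
rewrite [`|x|]xij real_normK ?num_real // (ord1 i) /dotp (bigD1 j) //= -expr2 lerDl.
by apply: sumr_ge0 => k _; rewrite -expr2 sqr_ge0.
Qed.

Lemma enorm_gt0 x : x != 0 -> 0 < enorm x.
Proof. by rewrite -dotp_eq0 /enorm sqrtr_gt0 lt0r dotp_ge0 => ->. Qed.

Lemma ler_enorm x y : (enorm x <= enorm y) = (dotp x x <= dotp y y).
Proof. by rewrite /enorm ler_psqrt // nnegrE dotp_ge0. Qed.

Lemma enormZ a x : 0 <= a -> enorm (a *: x) = a * enorm x.
Proof.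
move=> a0; rewrite /enorm dotpZl dotpZr mulrA -expr2 sqrtrM ?sqr_ge0 //.
by rewrite sqrtr_sqr ger0_norm.
Qed.

Lemma dotp_continuous x : continuous (dotp x).
Proof.
apply: continuous_big => [|i _ y]; first exact: add_continuous.
by apply: continuousM; [exact: cst_continuous|exact: coord_continuous].
Qed.

Lemma dotp_self_continuous : continuous (fun x => dotp x x).
Proof.
apply: continuous_big => [|i _ y]; first exact: add_continuous.
by apply: continuousM; exact: coord_continuous.
Qed.

Lemma dist_continuous x : continuous (fun y => dotp (x - y) (x - y)).
Proof.
have -> : (fun y => dotp (x - y) (x - y)) = (fun y => dotp y y) \o (fun y => x - y) by [].
move=> y; apply: continuous_comp; last exact: dotp_self_continuous.
by apply: continuousB; [exact: cst_continuous|exact: cvg_id].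
Qed.

End InnerProduct.

Lemma dotp_row_mx (R : realType) (m p : nat) (x x' : 'rV[R]_m) (y y' : 'rV[R]_p) :
  dotp (row_mx x y) (row_mx x' y') = dotp x x' + dotp y y'.
Proof.
rewrite /dotp big_split_ord /=; congr (_ + _); apply: eq_bigr => i _.
  by rewrite !row_mxEl.
by rewrite !row_mxEr.
Qed.

Lemma lsubmx_continuous (R : realType) (m p : nat) :
  continuous (@lsubmx R 1 m p).
Proof.
move=> z A /= /(nbhs_ballP (lsubmx z)) [e e0 eA].
apply/nbhs_ballP; exists e => // z' [_ zz']; apply: eA.
by split=> // i j; rewrite !mxE.
Qed.

(** With this sign the [u j] generate the polar of the cone of [b]. The relation is symmetric in [b]
    and [u], so each fact on coefficients along [b] also holds along [u]. *)
Definition biorthogonal (R : realType) (n : nat) (b u : 'I_n -> 'rV[R]_n) :=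
  forall i j, dotp (u j) (b i) = - (i == j)%:R.

(** * Coordinates in biorthogonal bases and existence of nearest points *)

Section Biorthogonal.
Context {R : realType} {n : nat} {b u : 'I_n -> 'rV[R]_n}.
Hypothesis bu : biorthogonal b u.

Lemma biorthogonal_sym : biorthogonal u b.
Proof. by move=> i j; rewrite dotpC bu eq_sym. Qed.

Lemma dotp_comb_dual (c : 'I_n -> R) j : dotp (\sum_i c i *: b i) (u j) = - c j.
Proof.
rewrite dotpC dotp_sumr (bigD1 j) //= dotpZr bu eqxx mulrN1.
by rewrite big1 ?addr0 // => i /negPf ij; rewrite dotpZr bu ij oppr0 mulr0.
Qed.

(** Biorthogonality says that [- U^T] is a right inverse of the square matrix [B]; it is then a left
    inverse too, which is the expansion. *)
Lemma biorthogonal_expand x : x = \sum_i (- dotp x (u i)) *: b i.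
Proof.
pose B := \matrix_i b i; pose U := \matrix_i u i.
have : B *m - U^T = 1%:M.
  apply/matrixP => i j; rewrite mulmxN !mxE.
  have := bu i j; rewrite dotpC => /(congr1 -%R); rewrite opprK => <-.
  by congr (- _); apply: eq_bigr => k _; rewrite !mxE.
move=> /mulmx1C UB; rewrite -[LHS]mulmx1 -UB mulmxA mulmx_sum_row.
apply: eq_bigr => i _; rewrite rowK mulmxN !mxE; congr (- _ *: _).
by apply: eq_bigr => k _; rewrite !mxE.
Qed.

Lemma dotp_comb_comb (a c : 'I_n -> R) :
  dotp (\sum_i a i *: b i) (\sum_i c i *: u i) = - \sum_i a i * c i.
Proof.
rewrite dotp_sumr -sumrN; apply: eq_bigr => j _.
by rewrite dotpZr dotp_comb_dual mulrN mulrC.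
Qed.

Lemma gen_coneP x : gen_cone b x <-> forall i, dotp x (u i) <= 0.
Proof.
split=> [[a a0 ->] i|x0]; first by rewrite dotp_comb_dual oppr_le0.
exists (fun i => - dotp x (u i)); last exact: biorthogonal_expand.
by move=> i; rewrite oppr_ge0.
Qed.

Lemma closed_gen_cone : closed (gen_cone b).
Proof.
have -> : gen_cone b = \bigcap_i [set x | dotp (u i) x <= 0].
  apply/seteqP; split=> [x /gen_coneP x0 i _|x x0]; first by rewrite /= dotpC.
  by apply/gen_coneP => i; rewrite dotpC; exact: x0.
apply: closed_bigI => i _.
by move: (@dotp_continuous _ _ (u i)) => /continuous_closedP /(_ _ (@closed_le _ 0)).
Qed.

(** Only points of the cone at least as close to [x] as 0 compete; they form a compact set, on which
    the squared distance attains its minimum. *)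
Lemma gen_cone_nearest x :
  exists2 p, gen_cone b p &
    forall q, gen_cone b q -> dotp (x - p) (x - p) <= dotp (x - q) (x - q).
Proof.
have K0 : gen_cone b 0 by apply/gen_coneP => i; rewrite dotpC dotp0r.
pose f q := dotp (x - q) (x - q).
have fc : continuous f := @dist_continuous _ _ x.
pose A := gen_cone b `&` [set q | f q <= f 0].
have Ac : compact A.
  apply: bounded_closed_compact; last first.
    apply: closedI; first exact: closed_gen_cone.
    by move: fc => /continuous_closedP /(_ _ (@closed_le _ (f 0))).
  (* The bound is the triangle inequality for [q = x - (x - q)], where [x - q] has squared norm at
     most [f 0]. *)
  exists (`|x| + Num.sqrt (f 0)); split; first exact: num_real.
  move=> M ltM q [_ /= qf]; apply: le_trans (ltW ltM).
  rewrite -[q](subKr x) (le_trans (ler_normB _ _)) // lerD2l.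
  by rewrite -(ler_pXn2r (ltn0Sn 1)) ?nnegrE ?sqrtr_ge0 // sqr_sqrtr ?dotp_ge0 //
    (le_trans (mx_norm_sqr_le_dotp _)).
have [|p /set_mem [Kp pf] pmin] := EVT_min_rV _ Ac (continuous_subspaceT fc).
  by exists 0; split => //=.
exists p => // q Kq.
have [qf|/ltW qf] := leP (f q) (f 0); last exact: le_trans qf.
by apply: pmin; apply: mem_set.
Qed.

(** * Variational characterisation of the projection *)

Local Notation proj := (metric_proj (gen_cone b)).

(** First-order optimality: if [d] made an acute angle with [x - p], a short admissible step along
    [d] would bring [p] closer to [x]. *)
Lemma nearest_variation x p d e : gen_cone b p ->
    (forall q, gen_cone b q -> dotp (x - p) (x - p) <= dotp (x - q) (x - q)) ->
    0 < e -> (forall t, 0 < t <= e -> gen_cone b (p + t *: d)) ->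
  dotp (x - p) d <= 0.
Proof.
move=> Kp pmin e0 Kd; rewrite leNgt; apply/negP => s0.
set s := dotp (x - p) d in s0; pose D := dotp d d.
have D0 : 0 <= D by exact: dotp_ge0.
(* The squared distance changes by [t * (t * D - 2 * s)], negative once [t * D <= s]; the
   denominator [D + 1] stays positive even if [D] is 0. *)
pose t := Num.min e (s / (D + 1)).
have t0 : 0 < t by rewrite lt_min e0 divr_gt0 // ltr_wpDl.
have te : 0 < t <= e by rewrite t0 ge_min lexx.
have tD : t * (D + 1) <= s by rewrite -ler_pdivlMr ?ltr_wpDl // ge_min lexx orbT.
have := pmin _ (Kd _ te).
rewrite opprD addrA; move: (x - p) @s s0 @t t0 te tD => r s s0 t t0 te tD.
rewrite dotpBl !dotpBr !dotpZl !dotpZr (dotpC d) -/s -/D.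
have -> : forall a, a - t * s - (t * s - t * (t * D)) = a + t * (t * D - 2 * s).
  by move=> a; ring.
rewrite lerDl pmulr_rge0 //; lra.
Qed.

(** The hypotheses put [x - p] in the polar cone and orthogonal to [p]. The resulting Pythagorean
    inequality [key] gives both minimality and uniqueness of [p]. *)
Lemma metric_projE x p : gen_cone b p -> (forall i, dotp (x - p) (b i) <= 0) ->
  dotp (x - p) p = 0 -> proj x = p.
Proof.
move=> Kp pb pp.
have key q : gen_cone b q ->
    dotp (x - p) (x - p) + dotp (p - q) (p - q) <= dotp (x - q) (x - q).
  move=> [a a0 qE]; have : dotp (x - p) q <= 0.
    rewrite qE dotp_sumr; apply: sumr_le0 => i _.
    by rewrite dotpZr mulr_ge0_le0.
  have -> : x - q = (x - p) + (p - q) by rewrite addrA subrK.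
  move: (x - p) pp => r pp rq; rewrite (dotpDl r) !(dotpDr _ r) (dotpC (p - q) r).
  rewrite (dotpBr r p) pp; lra.
apply: xget_unique => [|q [Kq qmin]].
  split=> // q Kq; rewrite ler_enorm (le_trans _ (key _ Kq)) // lerDl.
  exact: dotp_ge0.
have := qmin _ Kp; rewrite ler_enorm => /(le_trans (key _ Kq)).
rewrite gerDl => pq; apply/esym/eqP; rewrite -subr_eq0 -dotp_eq0.
by rewrite eq_le pq dotp_ge0.
Qed.

(** The nearest point can always be moved along [b i], which gives the sign condition, and along
    [- b i] while its own [b i] coefficient is positive, which gives complementarity. *)
Lemma metric_proj_spec x :
  [/\ gen_cone b (proj x), forall i, dotp (x - proj x) (b i) <= 0
    & forall i, dotp (proj x) (u i) * dotp (x - proj x) (b i) = 0].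
Proof.
have [p Kp pmin] := gen_cone_nearest x.
have pu i : dotp p (u i) <= 0 by move/gen_coneP: Kp; apply.
have pb i : dotp (x - p) (b i) <= 0.
  apply: (nearest_variation Kp pmin ltr01) => t /andP[t0 _].
  apply/gen_coneP => k; rewrite dotpDl dotpZl (dotpC (b i)) bu.
  rewrite mulrN subr_le0 (le_trans (pu k)) //.
  by rewrite mulr_ge0 ?ler0n ?ltW.
have pub i : dotp p (u i) * dotp (x - p) (b i) = 0.
  have [->|pui] := eqVneq (dotp p (u i)) 0; first by rewrite mul0r.
  apply/eqP; rewrite mulf_eq0 (negPf pui) eq_le pb /= -oppr_le0 -dotpNr.
  (* This is the coefficient of [b i] in [p], hence the length for which moving along [- b i] stays
     in the cone. *)
  have e0 : 0 < - dotp p (u i) by rewrite oppr_gt0 lt_neqAle pui pu.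
  apply: (nearest_variation Kp pmin e0) => t /andP[t0 te].
  apply/gen_coneP => k; rewrite dotpDl dotpZl dotpNl (dotpC (b i)) bu opprK.
  case: eqVneq => [<-|_]; last by rewrite mulr0 addr0.
  by rewrite mulr1 -lerBrDl sub0r.
suff -> : proj x = p by [].
apply: metric_projE => //; rewrite {2}(biorthogonal_expand p) dotp_sumr big1 // => i _.
by rewrite dotpZr mulNr pub oppr0.
Qed.

(* Moreau's decomposition [x = \sum_i cone_coef x i *: b i + \sum_i polar_coef x i *: u i]
   into nonnegative complementary parts, the first one being the projection. *)
Definition cone_coef x i := - dotp (proj x) (u i).
Definition polar_coef x i := - dotp (x - proj x) (b i).

Lemma cone_coef_ge0 x i : 0 <= cone_coef x i.
Proof. by rewrite oppr_ge0; have [/gen_coneP] := metric_proj_spec x. Qed.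

Lemma polar_coef_ge0 x i : 0 <= polar_coef x i.
Proof. by rewrite oppr_ge0; have [_ ->] := metric_proj_spec x. Qed.

Lemma cone_coef_polar_coef x i : cone_coef x i * polar_coef x i = 0.
Proof. by rewrite mulrNN; have [_ _ ->] := metric_proj_spec x. Qed.

Lemma proj_expand x : proj x = \sum_i cone_coef x i *: b i.
Proof. exact: biorthogonal_expand. Qed.

End Biorthogonal.

Arguments cone_coef {R n} b u x i.
Arguments polar_coef {R n} b x i.

(** * Moreau's decomposition and its uniqueness *)

Section Moreau.
Context {R : realType} {n : nat} {b u : 'I_n -> 'rV[R]_n}.
Hypothesis bu : biorthogonal b u.
Local Notation proj := (metric_proj (gen_cone b)).
Local Notation al := (cone_coef b u).
Local Notation be := (polar_coef b).

Lemma residual_expand x : x - proj x = \sum_i be x i *: u i.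
Proof. exact: (biorthogonal_expand (biorthogonal_sym bu)). Qed.

Lemma moreau_expand x : x = \sum_i al x i *: b i + \sum_i be x i *: u i.
Proof. by rewrite -(proj_expand bu) -residual_expand addrC subrK. Qed.

(** Complementarity makes the two sums orthogonal, so [metric_projE] recognises the first as the
    projection; pairing with the dual basis then reads off the coefficients. *)
Lemma moreau_unique x (a c : 'I_n -> R) :
    (forall i, 0 <= a i) -> (forall i, 0 <= c i) -> (forall i, a i * c i = 0) ->
    x = \sum_i a i *: b i + \sum_i c i *: u i ->
  proj x = \sum_i a i *: b i /\ forall i, al x i = a i /\ be x i = c i.
Proof.
move=> a0 c0 ac xE; set p := \sum_i a i *: b i.
have xp : x - p = \sum_i c i *: u i by rewrite xE addrC addKr.
have projx : proj x = p.
  apply: metric_projE; first by exists a.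
    by move=> i; rewrite xp (dotp_comb_dual (biorthogonal_sym bu)) oppr_le0.
  by rewrite xp dotpC (dotp_comb_comb bu) big1 ?oppr0.
split=> // i; rewrite /cone_coef /polar_coef projx xp (dotp_comb_dual bu).
by rewrite (dotp_comb_dual (biorthogonal_sym bu)) !opprK.
Qed.

End Moreau.

(** * The index sets expressed through the Moreau coefficients *)

Section IndexSets.
Context {R : realType} {n : nat} {b u : 'I_n -> 'rV[R]_n}.
Hypothesis bu : biorthogonal b u.
Local Notation al := (cone_coef b u).
Local Notation be := (polar_coef b).

Lemma cone_coef_eq0 x i : be x i != 0 -> al x i = 0.
Proof.
by have /eqP := cone_coef_polar_coef bu x i; rewrite mulf_eq0 => /orP[/eqP|->].
Qed.

Lemma polar_coef_eq0 x i : al x i != 0 -> be x i = 0.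
Proof.
by have /eqP := cone_coef_polar_coef bu x i; rewrite mulf_eq0 => /orP[->|/eqP].
Qed.

(** At each index at most one Moreau coefficient is nonzero, so their sum is whichever one the
    single family [c] has to record. Strict positivity on [I] is what pins [I] down. *)
Lemma is_reprP x I c : is_repr b u x I c <->
  I = [set i | 0 < be x i]%SET /\ c = [ffun i => al x i + be x i].
Proof.
split=> [[xE cI cIC]|[-> ->]].
  have [||||_ alb] := @moreau_unique _ _ _ _ bu x
    (fun i => if i \in I then 0 else c i) (fun i => if i \in I then c i else 0).
  - by move=> i; case: ifP => // iI; rewrite cIC // inE iI.
  - by move=> i; case: ifP => // /cI/ltW.
  - by move=> i; case: ifP; rewrite ?mul0r ?mulr0.
  - rewrite xE; congr (_ + _); rewrite big_mkcond; apply: eq_bigr => i _.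
      by rewrite inE; case: (i \in I); rewrite ?scale0r.
    by case: ifP; rewrite ?scale0r.
  split; [apply/setP => i; rewrite inE|apply/ffunP => i; rewrite ffunE].
    by have [_ ->] := alb i; case: ifP => [/cI->|]; rewrite ?ltxx.
  by have [-> ->] := alb i; case: ifP; rewrite ?add0r ?addr0.
have be0 i : (0 < be x i) = (be x i != 0) by rewrite lt0r (polar_coef_ge0 bu) andbT.
split=> [|j|i]; rewrite ?inE ?ffunE.
- rewrite [LHS](moreau_expand bu); congr (_ + _); rewrite [RHS]big_mkcond;
  apply: eq_bigr => i _; rewrite !inE ffunE be0;
  have [->|bi] := eqVneq (be x i) 0; rewrite ?addr0 ?scale0r //.
  + by rewrite (cone_coef_eq0 bi) scale0r.
  + by rewrite (cone_coef_eq0 bi) add0r.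
- by move=> bj; rewrite ltr_wpDl ?(cone_coef_ge0 bu).
- by move=> _; rewrite addr_ge0 ?(cone_coef_ge0 bu) ?(polar_coef_ge0 bu).
Qed.

Lemma idx_negE x : idx_neg b u x = [set i | 0 < be x i]%SET.
Proof.
apply: xget_unique; last by move=> I [c /is_reprP[]].
by eexists; apply/is_reprP; split.
Qed.

Lemma repr_coefE x : repr_coef b u x = [ffun i => al x i + be x i].
Proof.
apply: xget_unique; last by move=> c /is_reprP[].
by apply/is_reprP; rewrite idx_negE.
Qed.

Lemma idx_posE x : idx_pos b u x = [set i | 0 < al x i]%SET.
Proof.
apply/setP => i; rewrite !inE idx_negE repr_coefE inE ffunE lt0r (polar_coef_ge0 bu) andbT.
rewrite negbK; have [->|bi] := eqVneq (be x i) 0; first by rewrite addr0.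
by rewrite (cone_coef_eq0 bi) ltxx.
Qed.

Lemma idx_zeroE x : idx_zero b u x = [set i | (al x i == 0) && (be x i == 0)]%SET.
Proof.
apply/setP => i; rewrite !inE idx_negE repr_coefE inE ffunE lt0r (polar_coef_ge0 bu) andbT.
by rewrite negbK [RHS]andbC; have [->|_] := eqVneq (be x i) 0; rewrite ?addr0.
Qed.

End IndexSets.

(** * Two criteria linking the limsup definition to signs of inner products *)

Section FrechetNormal.
Context {R : realType} {m : nat}.
Implicit Types (Omega : set 'rV[R]_m) (w z d : 'rV[R]_m).

(** On a ray the difference quotient is the constant [dotp z d / enorm d], so a positive value would
    bound the limsup from below. *)
Lemma frechet_normal_le0 Omega w z d e : frechet_normal Omega w z ->
  0 < e -> (forall t, 0 < t < e -> Omega (w + t *: d)) -> dotp z d <= 0.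
Proof.
move=> [_ Nz] e0 Od; rewrite leNgt; apply/negP => s0.
have d0 : d != 0 by apply: contraTneq s0 => ->; rewrite dotp0r ltxx.
have r0 : 0 < dotp z d / enorm d by rewrite divr_gt0 // enorm_gt0.
have : (limf_esup (fun w' => (dotp z (w' - w) / enorm (w' - w))%:E)
  (within Omega w^') < (dotp z d / enorm d)%:E)%E.
  by apply: le_lt_trans Nz _; rewrite lte_fin.
rewrite limf_esupE => /ereal_inf_lt[_ [V FV <-]]; apply/negP; rewrite -leNgt.
(* The supremum of the quotient over [V] is below its value on the ray; a single ray point inside
   [V] refutes this. *)
have near_line : \forall t \near 0^'+, Omega (w + t *: d) -> V (w + t *: d).
  have line : w + t *: d @[t --> 0^'+] --> w.
    rewrite -[X in _ --> X]addr0 -[X in _ + X](scale0r d).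
    apply: cvgD; first exact: cvg_cst.
    by apply: cvgZl; exact: cvg_at_right_filter cvg_id.
  have lineV : \forall t \near (0 : R)^'+,
    w + t *: d != w -> Omega (w + t *: d) -> V (w + t *: d) by exact: line FV.
  have pos : \forall t \near (0 : R)^'+, 0 < t by exact: nbhs_right_gt.
  apply: filterS2 lineV pos => t Vt t0; apply: Vt.
  by rewrite -subr_eq0 addrC addKr scaler_eq0 negb_or d0 gt_eqF.
have [t [t0 te Vt]] : exists t, [/\ 0 < t, t < e & Omega (w + t *: d) -> V (w + t *: d)].
  near (0 : R)^'+ => t; exists t; split; near: t => //.
  - exact: nbhs_right_gt.
  - exact: nbhs_right_lt.
apply: ereal_sup_ubound; exists (w + t *: d); first by apply/Vt/Od; rewrite t0.
rewrite addrC addKr dotpZr enormZ ?ltW //.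
by rewrite -mulf_div divff ?gt_eqF // mul1r.
Unshelve. all: by end_near. Qed.

Lemma near_frechet_normal Omega w z : Omega w ->
  (\forall w' \near w, Omega w' -> dotp z (w' - w) <= 0) ->
  frechet_normal Omega w z.
Proof.
move=> Ow zw; split=> //; rewrite limf_esupE.
apply: (@le_trans _ _ (ereal_sup ((fun w' => (dotp z (w' - w) / enorm (w' - w))%:E) @`
  [set w' | dotp z (w' - w) <= 0]))).
  apply: ereal_inf_lbound; exists [set w' | dotp z (w' - w) <= 0] => //.
  have : \forall w' \near w, w' != w -> Omega w' -> dotp z (w' - w) <= 0.
    by apply: filterS zw => w' zw' _.
  exact.
(* The set contains [w] itself, where the quotient is 0 because the inverse of 0 is 0. *)
apply: ge_ereal_sup => _ [w' /= w'0 <-].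
by rewrite lee_fin mulr_le0_ge0 // invr_ge0 sqrtr_ge0.
Qed.

End FrechetNormal.

(** * Continuity of the Moreau coefficients and normals to the graph of the projection *)

Section GraphNormal.
Context {R : realType} {n : nat} {b u : 'I_n -> 'rV[R]_n}.
Hypothesis bu : biorthogonal b u.
Local Notation proj := (metric_proj (gen_cone b)).
Local Notation al := (cone_coef b u).
Local Notation be := (polar_coef b).
Implicit Types (x : 'rV[R]_n) (z : 'rV[R]_(n + n)).

(** Splitting [x - y] into projection and residual differences, the cross term is the sum of the
    [al x i * be y i + al y i * be x i], hence nonnegative. *)
Lemma metric_proj_nonexpansive x y :
  dotp (proj x - proj y) (proj x - proj y) <= dotp (x - y) (x - y).
Proof.
have -> : x - y = (proj x - proj y) + ((x - proj x) - (y - proj y)).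
  by rewrite addrACA -opprD !(addrC (proj _)) !subrK.
set p := proj x - proj y; set r := _ - _ - _.
have pr : 0 <= dotp p r.
  rewrite /p /r !(residual_expand bu) !(proj_expand bu) -!sumrB.
  under eq_bigr do rewrite -scalerBl.
  under [X in dotp _ X]eq_bigr do rewrite -scalerBl.
  rewrite (dotp_comb_comb bu) -sumrN; apply: sumr_ge0 => i _.
  rewrite mulrBl !mulrBr !(cone_coef_polar_coef bu) sub0r subr0 opprB opprK.
  by rewrite addr_ge0 // mulr_ge0 ?(cone_coef_ge0 bu) ?(polar_coef_ge0 bu).
clearbody p r; rewrite dotpDl !dotpDr (dotpC r p); have := dotp_ge0 r; lra.
Qed.

Lemma metric_proj_continuous : continuous proj.
Proof.
move=> x; apply/(@cvgrPdist_lt _ _ _ (nbhs x)) => e e0.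
have : \forall y \near x, dotp (x - y) (x - y) < e ^+ 2.
  have := @dist_continuous _ _ x x; rewrite /continuous_at subrr dotp0r => /cvgr_lt; apply.
  exact: exprn_gt0.
apply: filterS => y xy; rewrite -(ltr_pXn2r (ltn0Sn 1)) ?nnegrE ?(ltW e0) //.
apply: le_lt_trans xy; apply: le_trans (metric_proj_nonexpansive x y).
exact: mx_norm_sqr_le_dotp.
Qed.

Lemma cone_coef_continuous i : continuous (al ^~ i).
Proof.
have -> : al ^~ i = (fun y => - dotp (u i) y) \o proj.
  by apply/funext => x; rewrite /cone_coef dotpC.
move=> x; apply: continuous_comp; first exact: metric_proj_continuous.
by apply: continuousN; exact: dotp_continuous.
Qed.

Lemma polar_coef_continuous i : continuous (be ^~ i).
Proof.
have -> : be ^~ i = (fun y => - dotp (b i) y) \o (fun x => x - proj x).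
  by apply/funext => x; rewrite /polar_coef dotpC.
move=> x; apply: continuous_comp.
  by apply: continuousB; [exact: cvg_id|exact: metric_proj_continuous].
by apply: continuousN; exact: dotp_continuous.
Qed.

(** By complementarity, only indices at which both coefficients vanish can change case near [x]. *)
Lemma near_coef_gt0 x : \forall y \near x,
  forall i, (0 < al x i -> 0 < al y i) /\ (0 < be x i -> 0 < be y i).
Proof.
have pos (f : 'rV[R]_n -> R) : continuous f -> \forall y \near x, 0 < f x -> 0 < f y.
  move=> fc; have [fx|_] := ltP 0 (f x); last by near=> y.
  by have /cvgr_gt /(_ 0 fx) := fc x; apply: filterS.
have H i : \forall y \near x,
    (0 < al x i -> 0 < al y i) /\ (0 < be x i -> 0 < be y i).
  near=> y; split; near: y.
    exact: (pos (al ^~ i) (@cone_coef_continuous i)).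
  exact: (pos (be ^~ i) (@polar_coef_continuous i)).
exact: (@filter_forall _ _ _ (nbhs x) _ H).
Unshelve. all: by end_near. Qed.

(** Raising the [b i] coefficient moves a point and its projection alike, whence the direction
    [(b i, b i)]; raising the [u i] coefficient leaves the projection fixed, whence [(u i, 0)] in
    [slope_u]. *)
Definition slope_b z i := dotp z (row_mx (b i) (b i)).
Definition slope_u z i := dotp z (row_mx (u i) 0).

Lemma slope_b_row_mx (z1 z2 : 'rV[R]_n) i :
  slope_b (row_mx z1 z2) i = dotp z1 (b i) + dotp z2 (b i).
Proof. exact: dotp_row_mx. Qed.

Lemma slope_u_row_mx (z1 z2 : 'rV[R]_n) i :
  slope_u (row_mx z1 z2) i = dotp z1 (u i).
Proof. by rewrite /slope_u dotp_row_mx dotp0r addr0. Qed.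

Lemma slope_b_continuous i : continuous (slope_b ^~ i).
Proof.
have -> : slope_b ^~ i = dotp (row_mx (b i) (b i)).
  by apply/funext => z; exact: dotpC.
exact: dotp_continuous.
Qed.

Lemma slope_u_continuous i : continuous (slope_u ^~ i).
Proof.
have -> : slope_u ^~ i = dotp (row_mx (u i) 0).
  by apply/funext => z; exact: dotpC.
exact: dotp_continuous.
Qed.

(** Displacement of a graph point when its Moreau coefficients change by [a] along [b] and by [c]
    along [u]. *)
Definition graph_dir (a c : 'I_n -> R) : 'rV[R]_(n + n) :=
  row_mx (\sum_i a i *: b i + \sum_i c i *: u i) (\sum_i a i *: b i).

Lemma dotp_graph_dir z a c :
  dotp z (graph_dir a c) = \sum_i (a i * slope_b z i + c i * slope_u z i).
Proof.
rewrite -[z]hsubmxK dotp_row_mx dotpDr addrAC -dotpDl !dotp_sumr -big_split.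
by apply: eq_bigr => i _; rewrite slope_b_row_mx slope_u_row_mx -dotpDl !dotpZr.
Qed.

Lemma graph_dir_sub x y : row_mx y (proj y) - row_mx x (proj x) =
  graph_dir (fun i => al y i - al x i) (fun i => be y i - be x i).
Proof.
have bE : \sum_i (al y i - al x i) *: b i = proj y - proj x.
  by under eq_bigr do rewrite scalerBl; rewrite sumrB -!(proj_expand bu).
have uE : \sum_i (be y i - be x i) *: u i = (y - proj y) - (x - proj x).
  by under eq_bigr do rewrite scalerBl; rewrite sumrB -!(residual_expand bu).
rewrite opp_row_mx add_row_mx /graph_dir bE uE; congr row_mx.
by rewrite addrACA -opprD !(addrC (proj _)) !subrK.
Qed.

(** While the shifted coefficients stay nonnegative and complementary, [moreau_unique] makes them
    the coefficients of a new point, so the motion stays on the graph. *)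
Lemma graph_line x a c t :
    (forall i, [/\ 0 <= al x i + t * a i, 0 <= be x i + t * c i
                 & (al x i + t * a i) * (be x i + t * c i) = 0]) ->
  exists y, [/\ row_mx x (proj x) + t *: graph_dir a c = row_mx y (proj y),
    forall i, al y i = al x i + t * a i & forall i, be y i = be x i + t * c i].
Proof.
move=> ac; pose y := \sum_i (al x i + t * a i) *: b i + \sum_i (be x i + t * c i) *: u i.
have [||||projy coefy] := @moreau_unique _ _ _ _ bu y
  (fun i => al x i + t * a i) (fun i => be x i + t * c i) => //; try by move=> i; case: (ac i).
exists y; split=> [|i|i]; try by have [] := coefy i.
rewrite -[RHS](subrK (row_mx x (proj x))) graph_dir_sub addrC; congr (_ + _).
have bE : \sum_i (al y i - al x i) *: b i = t *: \sum_i a i *: b i.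
  rewrite scaler_sumr; apply: eq_bigr => i _.
  by have [-> _] := coefy i; rewrite addrC addKr scalerA.
have uE : \sum_i (be y i - be x i) *: u i = t *: \sum_i c i *: u i.
  rewrite scaler_sumr; apply: eq_bigr => i _.
  by have [_ ->] := coefy i; rewrite addrC addKr scalerA.
by rewrite /graph_dir bE uE scale_row_mx scalerDr.
Qed.

(** Necessity tests the normal on rays changing one coefficient; sufficiency bounds each term of the
    inner product with a nearby graph displacement. *)
Lemma frechet_normal_graphP x z :
  frechet_normal (graph proj) (row_mx x (proj x)) z <->
  forall i, [/\ 0 < al x i -> slope_b z i = 0, 0 < be x i -> slope_u z i = 0
    & al x i = 0 -> be x i = 0 -> slope_b z i <= 0 /\ slope_u z i <= 0].
Proof.
split=> [Nz i|slopes].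
  have dir a c e : 0 < e ->
      (forall t, 0 < t < e -> forall k, [/\ 0 <= al x k + t * a k,
        0 <= be x k + t * c k & (al x k + t * a k) * (be x k + t * c k) = 0]) ->
      \sum_k (a k * slope_b z k + c k * slope_u z k) <= 0.
    move=> e0 ac; rewrite -dotp_graph_dir; apply: (frechet_normal_le0 Nz e0) => t te.
    by have [y [-> _ _]] := graph_line (ac t te); exists y.
  (* Only the [b i] coefficient moves, at rate [s]; complementarity persists because its partner is
     0. *)
  have dirb s e : 0 < e -> be x i = 0 ->
      (forall t, 0 < t < e -> 0 <= al x i + t * s) -> s * slope_b z i <= 0.
    move=> e0 bi0 als; have := dir (fun k => if k == i then s else 0) (fun=> 0) e e0.
    rewrite (bigD1 i) //= eqxx mul0r addr0 big1 ?addr0; last first.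
      by move=> k /negPf->; rewrite !mul0r addr0.
    apply=> t te k; rewrite mulr0 addr0 (polar_coef_ge0 bu); case: eqP => [->|_].
      by rewrite als // bi0 mulr0.
    by rewrite mulr0 addr0 (cone_coef_ge0 bu) (cone_coef_polar_coef bu).
  have dirc s e : 0 < e -> al x i = 0 ->
      (forall t, 0 < t < e -> 0 <= be x i + t * s) -> s * slope_u z i <= 0.
    move=> e0 ai0 bes; have := dir (fun=> 0) (fun k => if k == i then s else 0) e e0.
    rewrite (bigD1 i) //= eqxx mul0r add0r big1 ?addr0; last first.
      by move=> k /negPf->; rewrite !mul0r addr0.
    apply=> t te k; rewrite mulr0 addr0 (cone_coef_ge0 bu); case: eqP => [->|_].
      by rewrite bes // ai0 mul0r.
    by rewrite mulr0 addr0 (polar_coef_ge0 bu) (cone_coef_polar_coef bu).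
  have b_le0 : be x i = 0 -> slope_b z i <= 0.
    move=> bi; rewrite -[leLHS]mul1r; apply: (dirb _ _ ltr01 bi) => t /andP[t0 _].
    by rewrite mulr1 addr_ge0 ?(cone_coef_ge0 bu) ?(ltW t0).
  have u_le0 : al x i = 0 -> slope_u z i <= 0.
    move=> ai; rewrite -[leLHS]mul1r; apply: (dirc _ _ ltr01 ai) => t /andP[t0 _].
    by rewrite mulr1 addr_ge0 ?(polar_coef_ge0 bu) ?(ltW t0).
  split=> [ai|bi|ai bi]; last by rewrite b_le0 // u_le0.
  (* Rate -1 is admissible up to time [al x i], and gives the reverse inequality. *)
  - have bi := polar_coef_eq0 bu (lt0r_neq0 ai).
    apply/eqP; rewrite eq_le b_le0 //= -oppr_le0 -mulN1r.
    by apply: (dirb _ _ ai bi) => t /andP[_ /ltW ta]; rewrite mulrN1 subr_ge0.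
  - have ai := cone_coef_eq0 bu (lt0r_neq0 bi).
    apply/eqP; rewrite eq_le u_le0 //= -oppr_le0 -mulN1r.
    by apply: (dirc _ _ bi ai) => t /andP[_ /ltW tb]; rewrite mulrN1 subr_ge0.
apply: near_frechet_normal; first by exists x.
have : \forall w \near row_mx x (proj x), forall i,
    (0 < al x i -> 0 < al (lsubmx w) i) /\ (0 < be x i -> 0 < be (lsubmx w) i).
  have := @lsubmx_continuous R n n (row_mx x (proj x)).
  rewrite /continuous_at row_mxKl => lx; exact: lx (near_coef_gt0 x).
apply: filterS => w near_x [y _ yw]; rewrite -{}yw row_mxKl in near_x *.
(* If one coefficient is positive at [x], its slope is 0 and its partner vanishes at [x] and [y], so
   the term is 0. Otherwise nonnegative coefficients of [y] multiply nonpositive slopes. *)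
rewrite graph_dir_sub dotp_graph_dir; apply: sumr_le0 => i _.
have [sb su s0] := slopes i; have [aly bey] := near_x i.
have := cone_coef_ge0 bu x i; rewrite le_eqVlt => /orP[/eqP ai|ai]; last first.
  have bi := polar_coef_eq0 bu (lt0r_neq0 ai).
  by rewrite sb // bi (polar_coef_eq0 bu (lt0r_neq0 (aly ai))) mulr0 subr0 mul0r addr0.
have := polar_coef_ge0 bu x i; rewrite le_eqVlt => /orP[/eqP bi|bi]; last first.
  by rewrite su // -ai (cone_coef_eq0 bu (lt0r_neq0 (bey bi))) mulr0 subr0 mul0r addr0.
have [sb0 su0] := s0 (esym ai) (esym bi).
rewrite -ai -bi !subr0 -[leRHS](addr0 0) lerD //.
  by rewrite mulr_ge0_le0 ?(cone_coef_ge0 bu).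
by rewrite mulr_ge0_le0 ?(polar_coef_ge0 bu).
Qed.

(** The alternatives are closed conditions on [z], so they survive the limit; conversely, a sequence
    with constant normal [z] realises them. *)
Lemma limiting_normal_graphP x z :
  limiting_normal (graph proj) (row_mx x (proj x)) z <->
  forall i, [/\ 0 < al x i -> slope_b z i = 0, 0 < be x i -> slope_u z i = 0
    & al x i = 0 -> be x i = 0 ->
      [\/ slope_b z i = 0, slope_u z i = 0 | slope_b z i <= 0 /\ slope_u z i <= 0]].
Proof.
split=> [[_ [w [v [wx vz wG vN]]]] i|slopes].
  have vN' k : frechet_normal (graph proj) (row_mx (lsubmx (w k)) (proj (lsubmx (w k)))) (v k).
    by have := vN k; have [y _ <-] := wG k; rewrite row_mxKl.
  have near_x : \forall k \near \oo, forall i,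
      (0 < al x i -> 0 < al (lsubmx (w k)) i) /\ (0 < be x i -> 0 < be (lsubmx (w k)) i).
    have := continuous_cvg _ (@lsubmx_continuous R n n _) wx.
    by rewrite row_mxKl => lwx; exact: lwx (near_coef_gt0 x).
  have cb S : closed S -> closed [set z' | S (slope_b z' i)].
    by move/continuous_closedP : (@slope_b_continuous i); apply.
  have cu S : closed S -> closed [set z' | S (slope_u z' i)].
    by move/continuous_closedP : (@slope_u_continuous i); apply.
  split=> [ai|bi|_ _].
  - apply: (@closed_cvg _ _ _ _ v _ (cb _ (@closed_eq _ 0)) _ z vz).
    apply: filterS near_x => k /(_ i)[/(_ ai) aki _].
    by have /frechet_normal_graphP/(_ i)[sb _ _] := vN' k; exact: sb.
  - apply: (@closed_cvg _ _ _ _ v _ (cu _ (@closed_eq _ 0)) _ z vz).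
    apply: filterS near_x => k /(_ i)[_ /(_ bi) bki].
    by have /frechet_normal_graphP/(_ i)[_ su _] := vN' k; exact: su.
  (* The index may switch case along the sequence; closedness of the whole union avoids extracting a
     subsequence. *)
  - suff : ([set z' | slope_b z' i = 0] `|` [set z' | slope_u z' i = 0] `|`
      ([set z' | slope_b z' i <= 0] `&` [set z' | slope_u z' i <= 0])) z.
      by move=> [[]|]; [constructor 1|constructor 2|constructor 3].
    apply: (@closed_cvg _ _ _ _ v _ _ _ z vz).
      apply: closedU; first exact: closedU (cb _ (@closed_eq _ 0)) (cu _ (@closed_eq _ 0)).
      exact: closedI (cb _ (@closed_le _ 0)) (cu _ (@closed_le _ 0)).
    apply: nearW => k; have /frechet_normal_graphP/(_ i)[sb su s0] := vN' k.
    have := cone_coef_ge0 bu (lsubmx (w k)) i.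
    rewrite le_eqVlt => /orP[/eqP ai|/sb]; last by left; left.
    have := polar_coef_ge0 bu (lsubmx (w k)) i.
    rewrite le_eqVlt => /orP[/eqP bi|/su]; last by left; right.
    by right; exact: s0.
split; first by exists x.
(* Indices with a vanishing b-slope are pushed along b, the remaining ones with a
   vanishing u-slope along u. *)
pose a i : R := [&& al x i == 0, be x i == 0 & slope_b z i == 0]%:R.
pose c i : R := [&& al x i == 0, be x i == 0, slope_b z i != 0 & slope_u z i == 0]%:R.
have line k i : [/\ 0 <= al x i + k.+1%:R^-1 * a i, 0 <= be x i + k.+1%:R^-1 * c i
    & (al x i + k.+1%:R^-1 * a i) * (be x i + k.+1%:R^-1 * c i) = 0].
  split; [by rewrite addr_ge0 ?(cone_coef_ge0 bu) ?mulr_ge0|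
          by rewrite addr_ge0 ?(polar_coef_ge0 bu) ?mulr_ge0|].
  rewrite /a /c; have := cone_coef_polar_coef bu x i.
  have [->|_] /= := eqVneq (al x i) 0; last by rewrite !mulr0 !addr0.
  have [->|_] /= := eqVneq (be x i) 0; last by rewrite !mulr0 !addr0.
  by case: eqP => /= _; rewrite ?mulr0 ?addr0 ?mulr0 ?mul0r.
exists (fun k => row_mx x (proj x) + k.+1%:R^-1 *: graph_dir a c), (fun=> z); split.
- rewrite -[X in _ --> X]addr0 -[X in _ + X](scale0r (graph_dir a c)).
  apply: cvgD; first exact: cvg_cst.
  by apply: cvgZl; exact: cvg_harmonic.
- exact: cvg_cst.
- by move=> k; have [y [-> _ _]] := graph_line (line k); exists y.
move=> k; have [y [-> aly bey]] := graph_line (line k).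
apply/frechet_normal_graphP => i; rewrite aly bey /a /c.
have [sb su s0] := slopes i; have t0 : 0 < k.+1%:R^-1 :> R by [].
have [ai|ai] /= := eqVneq (al x i) 0; last first.
  rewrite !mulr0 !addr0; split=> // /eqP; first by rewrite (negPf ai).
have [bi|bi] /= := eqVneq (be x i) 0; last first.
  by rewrite !mulr0 !addr0; split=> // _ /eqP; rewrite (negPf bi).
rewrite ai bi !add0r.
have [sbi|sbi] /= := eqVneq (slope_b z i) 0.
  rewrite mulr1 mulr0 sbi ltxx; split=> // t_0.
  by rewrite t_0 ltxx in t0.
have [sui|sui] /= := eqVneq (slope_u z i) 0.
  rewrite mulr1 mulr0 sui ltxx; split=> // _ t_0.
  by rewrite t_0 ltxx in t0.
(* Neither slope vanishes here, so the index was not moved and only the third alternative is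
   left. *)
rewrite !mulr0 ltxx; split=> // _ _.
by case: (s0 ai bi) => // /eqP; rewrite ?(negPf sbi) ?(negPf sui).
Qed.

End GraphNormal.

(** * Translation of the slope conditions on [(z, -y)] into the sets [I] and [J] *)

Theorem theorem3p9 (R : realType) (n : nat) (b u : 'I_n -> 'rV[R]_n)
    (n_ge1 : (1 <= n)%N)
    (b_free : free (codom b))
    (u_dual : forall i j : 'I_n, dotp (u j) (b i) = - (i == j)%:R)
    (K_isotone : isotone_projection (gen_cone b))
    (xbar y : 'rV[R]_n) :
  coderivative (metric_proj (gen_cone b)) xbar y =
  \bigcup_(IJ in [set IJ : {set 'I_n} * {set 'I_n} |
      [/\ IJ.1 \subset idx_zero b u xbar, IJ.2 \subset idx_zero b u xbar
        & IJ.1 :&: IJ.2 = finset.set0]])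
    [set z : 'rV[R]_n |
      [/\ forall i, i \in idx_pos b u xbar :|: IJ.1 ->
            dotp z (b i) = dotp y (b i),
          forall i, i \in idx_zero b u xbar :\: (IJ.1 :|: IJ.2) ->
            dotp z (b i) <= dotp y (b i),
          forall j, j \in idx_neg b u xbar :|: IJ.2 ->
            dotp z (u j) = 0
        & forall j, j \in idx_zero b u xbar :\: (IJ.1 :|: IJ.2) ->
            dotp z (u j) <= 0]].
Proof.
have bu : biorthogonal b u := u_dual.
rewrite (idx_posE bu) (idx_negE bu) (idx_zeroE bu).
apply/seteqP; split=> z; rewrite /coderivative /= (limiting_normal_graphP bu).
  move=> slopes.
  (* [I] takes the indices with vanishing b-slope and [J] the remaining ones with vanishing u-slope,
     which forces disjointness. Outside both, only the two inequalities can hold. *)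
  exists ([set i | [&& cone_coef b u xbar i == 0, polar_coef b xbar i == 0
      & dotp z (b i) == dotp y (b i)]]%SET,
    [set i | [&& cone_coef b u xbar i == 0, polar_coef b xbar i == 0,
      dotp z (b i) != dotp y (b i) & dotp z (u i) == 0]]%SET) => /=.
    split; first by apply/fintype.subsetP => i; rewrite !inE => /and3P[-> ->].
      by apply/fintype.subsetP => i; rewrite !inE => /and4P[-> ->].
    by apply/setP => i; rewrite !inE; case: (dotp z (b i) == _); rewrite ?andbF.
  split=> i; have := slopes i; rewrite slope_b_row_mx slope_u_row_mx dotpNl => -[sb su s0];
    rewrite !inE.
  - by move=> /orP[/sb /eqP|/and3P[_ _ /eqP]//]; rewrite subr_eq0 => /eqP.
  - move=> /andP[+ /andP[/eqP ai /eqP bi]]; rewrite ai bi eqxx /=.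
    case: eqP => //= zy; case: eqP => //= zu _.
    by case: (s0 ai bi) => [/eqP||[]] //; rewrite ?subr_eq0 ?subr_le0 // => /eqP.
  - by move=> /orP[/su|/and4P[_ _ _ /eqP]].
  - move=> /andP[+ /andP[/eqP ai /eqP bi]]; rewrite ai bi eqxx /=.
    case: eqP => //= zy; case: eqP => //= zu _.
    by case: (s0 ai bi) => [/eqP||[]] //; rewrite ?subr_eq0 // => /eqP.
move=> [[I J] /= [I0 J0 _]] [zb zb_le zu zu_le] i.
rewrite slope_b_row_mx slope_u_row_mx dotpNl; split=> [ai|bi|ai bi].
- by apply/eqP; rewrite subr_eq0 zb // !inE ai.
- by rewrite zu // !inE bi.
(* Membership in [I], in [J], or in neither selects the matching alternative. *)
have [iI|iI] := boolP (i \in I).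
  by constructor 1; apply/eqP; rewrite subr_eq0 zb // !inE iI orbT.
have [iJ|iJ] := boolP (i \in J); first by constructor 2; rewrite zu // !inE iJ orbT.
have i0 : i \in ([set k | (cone_coef b u xbar k == 0) && (polar_coef b xbar k == 0)] :\: (I :|: J))%SET.
  by rewrite !inE negb_or iI iJ ai bi eqxx.
by constructor 3; rewrite subr_le0 zb_le // zu_le.
Qed.
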